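(* Let $f$ be a $\mathbb C^{p\times q}$-valued rational function of finitely many complex variables $z_1,\ldots,z_M$, analytic in a neighborhood of the origin. Then $f$ is the image under the Hermite transform of an element $F\in (S_{-1})^{p\times q}$. Moreover, if $$f(z)=D+C\Big(I_N-\sum_{k=1}^M z_kA_k\Big)^{-1}\Big(\sum_{k=1}^M z_kB_k\Big)$$ is a realization of $f$ (with constant matrices $D\in\mathbb C^{p\times q}$, $C\in\mathbb C^{p\times N}$, $A_k\in\mathbb C^{N\times N}$, $B_k\in\mathbb C^{N\times q}$), then $$F=D+C\Big(I_N-\sum_{k=1}^M H_{e_k}A_k\Big)^{-\lozenge}\lozenge\Big(\sum_{k=1}^M H_{e_k}B_k\Big).$$
   Context: $\ell$ is the set of sequences $\alpha=(\alpha_1,\alpha_2,\ldots)$ of nonnegative integers with only finitely many nonzero entries; $e_k\in\ell$ has $k$-th entry $1$ and all other entries $0$. $(H_\alpha)_{\alpha\in\ell}$ is the Hermite basis of the white noise space; for the present purpose only formal series in the $H_\alpha$ matter, identified with their coefficient families, and $H_0=1$. For $r\in\mathbb N$ put $(2\mathbb N)^{-r\alpha}=\prod_j(2j)^{-r\alpha_j}$. The Kondratiev space $S_{-1}$ (here with complex coefficients) is the set of formal series $F=\sum_{\alpha\in\ell}c_\alpha H_\alpha$, $c_\alpha\in\mathbb C$, with $\sum_\alpha |c_\alpha|^2(2\mathbb N)^{-r\alpha}<\infty$ for some $r\in\mathbb N$. The Wick product is the bilinear product determined by $H_\alpha\lozenge H_\beta=H_{\alpha+\beta}$, i.e. the Cauchy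 product of coefficient families; it maps $S_{-1}\times S_{-1}$ to $S_{-1}$ and extends to matrices in the usual way. The Hermite transform ${\bf I}$ sends $\sum_\alpha c_\alpha H_\alpha$ to the power series $\sum_\alpha c_\alpha z^\alpha$, where $z=(z_1,z_2,\ldots)$ and $z^\alpha=z_1^{\alpha_1}z_2^{\alpha_2}\cdots$; for matrices it is applied entrywise. An analytic function of $z_1,\dots,z_M$ near the origin is identified with its Taylor series at the origin. For a square matrix $G$ with entries in $S_{-1}$ whose constant coefficient $G_0$ is zero, $(I-G)^{-\lozenge}=\sum_{k=0}^\infty G^{k\lozenge}$, where $G^{k\lozenge}$ is the $k$-fold Wick power; this series converges in the Kondratiev space. *)

(* Defs.v *)
From HB Require Import structures.
From mathcomp Require Import all_boot all_order all_algebra.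
From mathcomp Require Import finmap multiset.
From mathcomp Require Import complex.
(* The notations of mpoly clash with those of mathcomp-analysis. *)
From mathcomp Require Import -(notations) mpoly.
From mathcomp Require Import all_classical all_reals all_analysis.
From mathcomp.analysis.showcase Require Import summability.

Set Implicit Arguments.
Unset Strict Implicit.
Unset Printing Implicit Defensive.

Import Order.TTheory GRing.Theory Num.Theory.
Import numFieldNormedType.Exports.

Local Open Scope classical_set_scope.
Local Open Scope ring_scope.

(* Finitely supported sequences of natural numbers. Positions are numbered
   from 0: the k-th entry of a : ell is the entry alpha_(k+1). The sum of
   sequences is msetD, the order is entrywise, and e_(k+1) is [mset k]. *)
Notation ell := {mset nat}%mset.

Definition fseries (K : Type) : Type := ell -> K.

Section WickRing.
Variable K : comNzRingType.
Implicit Types u v w : fseries K.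

HB.instance Definition _ := GRing.Zmodule.copy (fseries K) (ell -> K).

Definition wick u v : fseries K :=
  fun a => \sum_(b \in [set b : ell | (b `<=` a)%mset]) u b * v (a `\` b)%mset.

Definition Hbasis (b : ell) : fseries K := fun a => (a == b)%:R.

Lemma finite_msubset (a : ell) : finite_set [set b : ell | (b `<=` a)%mset].
Proof.
rewrite -(seq_mset_id a); elim: (a : seq nat) => [|x s IHs].
  rewrite (_ : [set _ | _] = [set mset0])//; apply/seteqP.
  have -> : seq_mset [::] = mset0 :> ell by apply/msetP => i; rewrite mset0E mset_seqE.
  split=> b /=; first by rewrite msubset0 => /eqP.
  by move=> ->; exact: msubset_refl.
rewrite mset_cons; apply: (@sub_finite_set _ _
  ([set b : ell | (b `<=` seq_mset s)%mset] `|`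
   (fun b : ell => (x +` b)%mset) @` [set b : ell | (b `<=` seq_mset s)%mset])).
  move=> b /= ba; have [xb|xb] := boolP (x \in b).
    right; exists (b `\ x)%mset; last by rewrite msetBDKC// msub1set.
    by rewrite subset_msetBLR.
  by left; rewrite -(mem_msetD1 xb) subset_msetBLR.
by rewrite finite_setU; split => //; exact: finite_image.
Qed.

Local Notation S a := (fset_set [set b : ell | (b `<=` a)%mset]).

Let inS a b : (b \in S a) = (b `<=` a)%mset.
Proof.
rewrite in_fset_set; last exact: finite_msubset.
by apply/idP/idP => [/set_mem|?]; [|exact/mem_set].
Qed.

Let wickS u v a : wick u v a = \sum_(b <- S a) u b * v (a `\` b)%mset.
Proof. by rewrite /wick fsbig_finite//; exact: finite_msubset. Qed.

Let wickE u v (a c : ell) : (c `<=` a)%mset -> wick u v c =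
  \sum_(b <- S a) \sum_(d <- S a) if (b `+` d)%mset == c then u b * v d else 0.
Proof.
move=> ca; transitivity
  (\sum_(b <- S a | (b `<=` c)%mset) u b * v (c `\` b)%mset).
  rewrite wickS -[RHS]big_filter; apply: perm_big; apply: uniq_perm.
  - exact: fset_uniq.
  - exact/filter_uniq/fset_uniq.
  - move=> b; rewrite mem_filter !inS.
    by have [bc|//] := boolP (b `<=` c)%mset; rewrite (msubset_trans bc ca).
rewrite big_mkcond [RHS]big_seq [LHS]big_seq.
apply: eq_bigr => b; rewrite inS => ba; case: ifPn => [bc|bc].
  rewrite (@bigD1_seq _ _ _ _ _ (c `\` b)%mset) ?fset_uniq//=; last first.
    by rewrite inS (msubset_trans _ ca)// msubsetDl.
  rewrite msetBDKC// eqxx big1 ?addr0// => d dcb.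
  by case: eqP => // E; rewrite -E msetDKB eqxx in dcb.
by rewrite big1// => d _; case: eqP => // E; rewrite -E -[X in msubset X _]msetD0 msetDS ?msub0set in bc.
Qed.

Let wick3 u v w a : wick u (wick v w) a =
  \sum_(b <- S a) \sum_(e <- S a) \sum_(f <- S a)
    if (b `+` (e `+` f))%mset == a then u b * (v e * w f) else 0.
Proof.
rewrite (wickE _ _ (msubset_refl a)); apply: eq_bigr => b _.
transitivity (\sum_(d <- S a) \sum_(e <- S a) \sum_(f <- S a)
  if ((b `+` d)%mset == a) && ((e `+` f)%mset == d)
  then u b * (v e * w f) else 0).
  rewrite [LHS]big_seq [RHS]big_seq; apply: eq_bigr => d; rewrite inS => da.
  case: eqP => _ /=; last by rewrite big1// => e _; rewrite big1.
  rewrite (wickE _ _ da) mulr_sumr; apply: eq_bigr => e _.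
  rewrite mulr_sumr; apply: eq_bigr => f _.
  by case: eqP => // _; rewrite mulr0.
rewrite exchange_big; apply: eq_bigr => e _.
rewrite exchange_big; apply: eq_bigr => f _ /=.
have [befa|befa] := eqVneq (b `+` (e `+` f))%mset a.
  rewrite (@bigD1_seq _ _ _ _ _ (e `+` f)%mset) ?fset_uniq//=; last first.
    by rewrite inS -befa -[X in msubset X _]mset0D msetSD ?msub0set.
  rewrite befa !eqxx big1 ?addr0// => d; rewrite eq_sym => /negbTE ->.
  by rewrite andbF.
rewrite big1// => d _; case: ifP => // /andP[+ /eqP defd].
by rewrite -defd (negbTE befa).
Qed.

Let wickC : commutative wick.
Proof.
move=> u v; apply/funext => a; rewrite !(wickE _ _ (msubset_refl a)).
rewrite exchange_big; apply: eq_bigr => b _; apply: eq_bigr => d _.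
by rewrite msetDC mulrC.
Qed.

Let wickA : associative wick.
Proof.
move=> u v w; apply/funext => a; rewrite (wickC (wick u v)) !wick3.
rewrite [RHS]exchange_big; apply: eq_bigr => b _.
rewrite [RHS]exchange_big; apply: eq_bigr => e _.
apply: eq_bigr => f _; rewrite (msetDC f) msetDA.
by case: eqP => // _; rewrite mulrA mulrC.
Qed.

Let wick1 : left_id (Hbasis mset0) wick.
Proof.
move=> u; apply/funext => a; rewrite wickS.
rewrite (@bigD1_seq _ _ _ _ _ mset0) ?fset_uniq ?inS ?msub0set//=.
rewrite /Hbasis eqxx mul1r msetB0 big1 ?addr0// => b /negbTE ->.
by rewrite mul0r.
Qed.

Let wickDl : left_distributive wick +%R.
Proof.
move=> u v w; apply/funext => a.
rewrite -[RHS]/(wick u w a + wick v w a) !wickS -big_split /=.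
by apply: eq_bigr => b _; rewrite -mulrDl.
Qed.

Let Hbasis0_neq0 : Hbasis mset0 != 0.
Proof.
apply/eqP => /(congr1 (fun u => u mset0)) /eqP.
by rewrite /Hbasis eqxx oner_eq0.
Qed.

(* The ring product on formal series is the Wick product and its unit is H_0;
   products and powers of matrices of formal series are then Wick products. *)
HB.instance Definition _ := GRing.Zmodule_isComNzRing.Build (fseries K)
  wickA wickC wick1 wickDl Hbasis0_neq0.

Lemma wick_mulE u v : u * v = wick u v.
Proof. by []. Qed.

Lemma HbasisM (a b : ell) : Hbasis a * Hbasis b = Hbasis (a `+` b)%mset.
Proof.
apply/funext => c; rewrite wick_mulE wickS /Hbasis.
have [ac|ac] := boolP (a `<=` c)%mset.
  rewrite (@bigD1_seq _ _ _ _ _ a) ?fset_uniq ?inS//= eqxx mul1r.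
  rewrite big1 ?addr0 => [|e /negbTE ->]; last by rewrite mul0r.
  have -> : ((c `\` a)%mset == b) = (c == (a `+` b)%mset).
    by apply/eqP/eqP => [<-|->]; [rewrite msetBDKC|rewrite msetDKB].
  by [].
rewrite big_seq big1 => [|e]; last first.
  rewrite inS => ec; have [ea|_] := eqVneq e a; last by rewrite mul0r.
  by rewrite -ea ec in ac.
case: eqP => // E; case/negP: ac.
by rewrite E -[X in msubset X _]msetD0 msetDS ?msub0set.
Qed.

Definition wconst (c : K) : fseries K := fun a => c *+ (a == mset0).

End WickRing.

Section Kondratiev.
Variable R : realType.
Local Notation C := R[i].

(* (2N)^(-r alpha): the entry a k is alpha_(k+1), whence the base 2 (k + 1). *)
Definition kweight (r : nat) (a : ell) : R :=
  \prod_(k <- finsupp a) (2 * k.+1)%:R ^- (r * a k).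

Definition knorm2 (r : nat) (F : fseries C) : \bar R :=
  \esum_(a in [set: ell]) (complex.Re (`|F a| ^+ 2) * kweight r a)%:E.

Definition kondratiev (F : fseries C) : Prop :=
  exists r : nat, (knorm2 r F < +oo)%E.

(* S_{-1} is the inductive limit of the Hilbert spaces {F | knorm2 r F < +oo};
   a sequence converges in it when it lies and converges in one of them. *)
Definition kcvg (u : nat -> fseries C) (l : fseries C) : Prop :=
  exists r : nat, [/\ forall n, (knorm2 r (u n) < +oo)%E,
    (knorm2 r l < +oo)%E &
    (fun n => knorm2 r (u n - l)) @ \oo --> (0 : \bar R)%E].

(* E is the sum of the convergent series of Wick powers defining
   (I - G)^(-<>). *)
Definition wick_geometric N (G E : 'M[fseries C]_N) : Prop :=
  forall i j, kcvg (fun n => (\sum_(k < n) G ^+ k) i j) (E i j).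

End Kondratiev.

(* Formal power series sum_alpha c_alpha z^alpha in z = (z_1, z_2, ...), given
   by their coefficients, with the indexing of ell. *)
Definition zseries (K : Type) : Type := ell -> K.

Definition hermite (K : Type) (F : fseries K) : zseries K := F.

Section Taylor.
Variable K : numFieldType.

Definition monomial_at M (z : 'rV[K]_M) (a : ell) : K :=
  \prod_(k < M) z ord0 k ^+ a k.

(* T is a power series in the first M variables only, and its terms at z - w
   have the (unconditional) sum g z for all z near w. *)
Definition taylor M (g : 'rV[K]_M -> K) (w : 'rV[K]_M) (T : zseries K) : Prop :=
  (forall (a : ell) k, (M <= k)%N -> a k != 0%N -> T a = 0) /\
  \forall z \near w,
    partial_sum (fun a => T a * monomial_at (z - w) a) @ totally --> g z.

Definition analytic_near M (g : 'rV[K]_M -> K) (w : 'rV[K]_M) : Prop :=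
  \forall v \near w, exists T, taylor g v T.

End Taylor.

Notation ratfun K M := {fraction mpoly M K}.

Section Rational.
Variables (K : numFieldType) (M : nat).

Definition rconst (c : K) : ratfun K M := tofrac (mpolyC M c).
Definition rvar (k : 'I_M) : ratfun K M := tofrac (mpolyX K (mnm1 k)).

Definition rvalue (x : ratfun K M) (z : 'rV[K]_M) (c : K) : Prop :=
  exists P Q : mpoly M K, [/\ x = tofrac P / tofrac Q,
    meval (z ord0) Q != 0 & c = meval (z ord0) P / meval (z ord0) Q].

(* Near the origin, g agrees with x wherever x has a value. *)
Definition rational_germ (x : ratfun K M) (g : 'rV[K]_M -> K) : Prop :=
  \forall z \near (0 : 'rV[K]_M), forall c, rvalue x z c -> g z = c.

Definition ranalytic0 (x : ratfun K M) : Prop :=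
  exists2 g, rational_germ x g & analytic_near g 0.

Definition rtaylor0 (x : ratfun K M) (T : zseries K) : Prop :=
  exists2 g, rational_germ x g & taylor g 0 T.

End Rational.

(* Main.v *)
(* The Taylor series T of f at the origin is F. Summability of T at one point
   with nonzero coordinates gives |T_a| <= S B^|a|, and T involves only
   finitely many variables, so a geometric series bounds its Kondratiev norm
   for large r. For a realization let d = det (I - sum_k z_k A_k), so d(0) = 1
   and f = P / d with P polynomial; near 0, d f = P. Comparing with truncations
   of T modulo O(|z|^n) turns this into the formal identity d T = P. The Neumann
   series E = sum_n G^n satisfies (I - G) E = I, whence d E = adj (I - G) and
   d (D + C E (sum_k H_(e_k) B_k)) = P; finally d cancels because
   d * det E = 1. *)
From HB Require Import structures.
Require Import Defs.
From mathcomp Require Import all_boot all_order all_algebra.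
From mathcomp Require Import finmap multiset complex.
From mathcomp Require Import -(notations) mpoly.
From mathcomp Require Import all_classical all_reals all_analysis.
From mathcomp.analysis.showcase Require Import summability.
From mathcomp Require Import ring.
Import Order.TTheory GRing.Theory Num.Theory.
Import numFieldNormedType.Exports.
Local Open Scope ring_scope.
Set Implicit Arguments.
Unset Strict Implicit.
Unset Printing Implicit Defensive.

(** * Multi-indices on the first [M] positions and their geometric sums *)

Section Multiindices.
Variable M : nat.
Implicit Types a b : ell.

Definition mdegree a : nat := (\sum_(k < M) a k)%N.

(** Convertible to the first clause of [taylor], so a Taylor series supplies it directly. *)
Definition confined (K : zmodType) (u : fseries K) : Prop :=
  forall a k, (M <= k)%N -> a k != 0%N -> u a = 0.

Definition ellof (f : 'I_M -> nat) : ell :=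
  \big[@msetD nat/mset0]_(k < M) msetn (f k) (k : nat).

Lemma ellofE (f : 'I_M -> nat) j : ellof f j = (\sum_(k < M) if j == k then f k else 0)%N.
Proof.
rewrite /ellof (big_morph (fun a : ell => a j) (id1 := 0%N) (op1 := addn)).
- by apply: eq_bigr => k _; rewrite msetnE.
- by move=> x y; rewrite msetE2.
- by rewrite mset0E.
Qed.

Lemma ellof_ord (f : 'I_M -> nat) (k : 'I_M) : ellof f k = f k.
Proof.
rewrite ellofE (bigD1 k)//= eqxx big1 ?addn0// => i /negbTE ik.
by rewrite (_ : (k == i :> nat) = false)// eq_sym.
Qed.

Lemma ellof_out (f : 'I_M -> nat) k : (M <= k)%N -> ellof f k = 0%N.
Proof.
move=> Mk; rewrite ellofE big1// => i _; case: eqP => // ki.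
by move: (ltn_ord i); rewrite -ki ltnNge Mk.
Qed.

Lemma ellofK a : (forall k, (M <= k)%N -> a k = 0%N) ->
  ellof (fun k => a k) = a.
Proof.
move=> aM; apply/msetP => j; have [jM|Mj] := ltnP j M.
  exact: (ellof_ord (fun k : 'I_M => a k) (Ordinal jM)).
by rewrite ellof_out// aM.
Qed.

Lemma mdegree_ellof (f : 'I_M -> nat) : mdegree (ellof f) = (\sum_(k < M) f k)%N.
Proof. by apply: eq_bigr => k _; rewrite ellof_ord. Qed.

Lemma mdegreeBK a b : (b `<=` a)%mset ->
  mdegree a = (mdegree b + mdegree (a `\` b)%mset)%N.
Proof.
move=> ba; rewrite -big_split /=; apply: eq_bigr => k _.
by rewrite -{1}(msetBDKC ba) msetE2.
Qed.

(** Over a cube of side [n] that contains [A], the sum factors into [M] partial geometric series,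
    each at most 2. *)
Lemma sum_half_mdegree (K : numFieldType) (A : {fset ell}) :
  (forall a k, a \in A -> (M <= k)%N -> a k = 0%N) ->
  \sum_(a <- A) 2^-1 ^+ mdegree a <= 2 ^+ M :> K.
Proof.
move=> AM; have h0 : 0 <= 2^-1 :> K by rewrite invr_ge0.
(* [n] exceeds each of the first [M] entries of every member of [A]. *)
pose n := (\sum_(a <- A) mdegree a).+1.
have An a k : a \in A -> (k < M)%N -> (a k < n)%N.
  move=> aA kM; rewrite ltnS /n (big_rem a aA)/=; apply: leq_trans (leq_addr _ _).
  by rewrite /mdegree (bigD1 (Ordinal kM))//= leq_addr.
pose h (f : {ffun 'I_M -> 'I_n}) := ellof (fun k => f k).
have hA a : a \in A -> exists f, h f = a.
  move=> aA; exists [ffun k : 'I_M => inord (a k)].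
  rewrite -[RHS]ellofK//; last by move=> k; exact: AM.
  apply/msetP => j; rewrite !ellofE; apply: eq_bigr => k _.
  by rewrite ffunE inordK// An.
apply: (@le_trans _ _ (\sum_f 2^-1 ^+ mdegree (h f))).
  apply: (@le_trans _ _ (\sum_(a <- A) \sum_(f | h f == a) 2^-1 ^+ mdegree (h f))).
    rewrite big_seq [leRHS]big_seq; apply: ler_sum => a /hA[f <-].
    rewrite (bigD1 f)//= lerDl; apply: sumr_ge0 => *; exact: exprn_ge0.
  rewrite (exchange_big_dep xpredT)//=; apply: ler_sum => f _.
  (* As [A] has no repetitions, at most one of its members equals [h f]. *)
  rewrite -big_filter big_const_seq count_predT iter_addr_0.
  have := fset_uniq A => /(filter_uniq (fun a => h f == a)).
  have : all (pred1 (h f)) [seq a <- A | h f == a].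
    by apply/allP => a; rewrite mem_filter => /andP[/eqP <- _] /=.
  case: [seq _ <- _ | _] => [_ _|a [|b s]] //=.
    by rewrite exprn_ge0.
  by move=> /and3P[/eqP -> /eqP -> _]; rewrite inE eqxx.
rewrite (eq_bigr (fun f : {ffun 'I_M -> 'I_n} => \prod_k 2^-1 ^+ (f k : nat))); last first.
  move=> f _; rewrite mdegree_ellof.
  by rewrite (big_morph (GRing.exp (2^-1 : K)) (id1 := 1) (op1 := *%R))// => x y; rewrite exprD.
rewrite -(bigA_distr_bigA (fun (_ : 'I_M) (j : 'I_n) => 2^-1 ^+ j : K)).
apply: (@le_trans _ _ (\prod_(i < M) 2)); last by rewrite prodr_const card_ord.
apply: ler_prod => i _; rewrite sumr_ge0/=; last by move=> *; exact: exprn_ge0.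
(* Partial geometric sums satisfy s_(n+1) = 1 + s_n / 2, so the bound 2 is inductive. *)
elim: n {An h hA} => [|n IH]; first by rewrite big_ord0.
rewrite big_ord_recl expr0 (eq_bigr (fun j : 'I_n => 2^-1 * 2^-1 ^+ j)); last first.
  by move=> j _; rewrite /= exprS.
rewrite -mulr_sumr -lerBrDl; apply: le_trans (ler_wpM2l h0 IH) _.
by rewrite mulVf ?pnatr_eq0// [X in X - 1](natrD _ 1 1) addrK.
Qed.

Lemma confined_eq0 (K : zmodType) (u : fseries K) a :
  confined u -> a != ellof (fun k => a k) -> u a = 0.
Proof.
move=> uM aM; apply: contrapT => ua; case/eqP: aM; apply/esym/ellofK => k Mk.
by apply: contrapT => /eqP ak; apply: ua; exact: uM ak.
Qed.

(** Indices with an entry outside the first [M] positions contribute nothing; the others are summed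
    geometrically. Serves both for Taylor remainders and for Kondratiev norms. *)
Lemma sum_confined_le (K : numFieldType) (u : fseries K) (S : K) (A : {fset ell}) :
  0 <= S -> confined u -> (forall a, u a <= S * 2^-1 ^+ mdegree a) ->
  \sum_(a <- A) u a <= S * 2 ^+ M.
Proof.
move=> S0 uM uS; pose P a := a == ellof (fun k => a k).
rewrite (bigID P)/= [X in _ + X]big1 ?addr0; last by move=> a /confined_eq0 ->.
rewrite big_fset_condE/=; apply: (@le_trans _ _
    (\sum_(a <- [fset a in A | P a]%fset) S * 2^-1 ^+ mdegree a)).
  exact: ler_sum.
rewrite -mulr_sumr ler_wpM2l// sum_half_mdegree// => a k.
by rewrite !inE => /andP[_ /eqP ->] Mk; rewrite ellof_out.
Qed.

End Multiindices.

(** * Coefficients, constants and order in the Wick algebra *)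

Section WickCoefficients.
Variables (K : comNzRingType) (M : nat).
Implicit Types (a b : ell) (u v : fseries K) (c : K).

Lemma fseriesD u v a : (u + v) a = u a + v a. Proof. by []. Qed.

Lemma fseriesB u v a : (u - v) a = u a - v a. Proof. by []. Qed.

Lemma fseries_sum (I : Type) (s : seq I) (P : pred I) (F : I -> fseries K) a :
  (\sum_(i <- s | P i) F i) a = \sum_(i <- s | P i) F i a.
Proof. by rewrite (big_morph (fun u : fseries K => u a) (id1 := 0) (op1 := +%R)). Qed.

Lemma wick_coefE u v a :
  (u * v) a = \sum_(b <- fset_set [set b : ell | (b `<=` a)%mset]%classic)
                u b * v (a `\` b)%mset.
Proof. by rewrite wick_mulE /wick fsbig_finite//; exact: finite_msubset. Qed.

Lemma mem_fset_msubset a b :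
  (b \in fset_set [set b : ell | (b `<=` a)%mset]%classic) = (b `<=` a)%mset.
Proof.
rewrite in_fset_set; last exact: finite_msubset.
by apply/idP/idP => [/set_mem|?]; [|exact/mem_set].
Qed.

Lemma Hbasis_mulE b u a :
  (Hbasis K b * u) a = if (b `<=` a)%mset then u (a `\` b)%mset else 0.
Proof.
rewrite wick_coefE /Hbasis; case: ifPn => ba.
  rewrite (@bigD1_seq _ _ _ _ _ b) ?fset_uniq ?mem_fset_msubset//= eqxx mul1r.
  by rewrite big1 ?addr0 => // d /negbTE ->; rewrite mul0r.
rewrite big_seq big1// => d; rewrite mem_fset_msubset.
by case: eqP => [->|_]; [rewrite (negbTE ba)|rewrite mul0r].
Qed.

Lemma Hbasis0 : Hbasis K mset0 = 1. Proof. by []. Qed.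

Lemma wconstE c a : wconst c a = c * (Hbasis K mset0) a.
Proof. by rewrite /wconst /Hbasis mulr_natr. Qed.

Lemma wconst_mulE c u a : (wconst c * u) a = c * u a.
Proof.
rewrite -[in RHS](mul1r u) -Hbasis0 !wick_coefE mulr_sumr.
by apply: eq_bigr => b _; rewrite wconstE mulrA.
Qed.

Lemma wconst_is_additive : zmod_morphism (@wconst K).
Proof. by move=> c d; apply/funext => a; rewrite fseriesB !wconstE mulrBl. Qed.

Lemma wconst_is_multiplicative : monoid_morphism (@wconst K).
Proof.
split; first by apply/funext => a; rewrite wconstE mul1r.
by move=> c d; apply/funext => a; rewrite wconst_mulE !wconstE mulrA.
Qed.

HB.instance Definition _ :=
  GRing.isZmodMorphism.Build K (fseries K) (@wconst K) wconst_is_additive.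
HB.instance Definition _ :=
  GRing.isMonoidMorphism.Build K (fseries K) (@wconst K) wconst_is_multiplicative.

(** The degree filtration. It takes the place of limits: equality of series is tested modulo each of
    its steps. *)
Definition order_ge (n : nat) u : Prop :=
  forall a, (mdegree M a < n)%N -> u a = 0.

Lemma order_ge0 u : order_ge 0 u. Proof. by []. Qed.

Lemma order_geD n u v : order_ge n u -> order_ge n v -> order_ge n (u + v).
Proof. by move=> un vn a an; rewrite fseriesD un// vn// addr0. Qed.

Lemma order_geN n u : order_ge n u -> order_ge n (- u).
Proof. by move=> un a an; rewrite -[LHS]/(- u a) un// oppr0. Qed.

Lemma order_ge_sum n (I : Type) (s : seq I) (P : pred I) (F : I -> fseries K) :
  (forall i, P i -> order_ge n (F i)) -> order_ge n (\sum_(i <- s | P i) F i).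
Proof. by move=> Fn a an; rewrite fseries_sum big1// => i /Fn ->. Qed.

(** Degree is additive in the splitting of [a] into [b] and the rest, so below degree [m + n] one of
    the two factors is below its order. *)
Lemma order_geM m n u v :
  order_ge m u -> order_ge n v -> order_ge (m + n) (u * v).
Proof.
move=> um vn a; rewrite wick_coefE => amn.
rewrite big_seq big1// => b; rewrite mem_fset_msubset => ba.
have [bm|mb] := ltnP (mdegree M b) m; first by rewrite um// mul0r.
rewrite vn ?mulr0//; move: amn; rewrite (mdegreeBK _ ba).
by apply: contraTT; rewrite -!leqNgt; exact: leq_add.
Qed.

Lemma order_geMl n u v : order_ge n v -> order_ge n (u * v).
Proof. by rewrite -[n]add0n; apply: order_geM. Qed.

(** The filtration is separated: the coefficient at [a] is decided at n = |a| + 1. *)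
Lemma order_ge_eq u v : (forall n, order_ge n (u - v)) -> u = v.
Proof.
move=> uv; apply/funext => a; apply/eqP; rewrite -subr_eq0 -fseriesB.
by rewrite (uv (mdegree M a).+1).
Qed.

End WickCoefficients.

(** * Polynomials embedded in the Wick algebra *)

Section PolynomialSeries.
Variables (K : comNzRingType) (M : nat).
Implicit Types (p : mpoly M K) (T : fseries K).

(** The inverse of the Hermite transform on polynomials. As a ring morphism it carries determinant
    and adjugate identities over to series. *)
Definition wickpoly : mpoly M K -> fseries K :=
  mmap (@wconst K) (fun k : 'I_M => Hbasis K [mset (k : nat)]%mset).

HB.instance Definition _ := GRing.RMorphism.on wickpoly.

Lemma wickpolyC c : wickpoly (mpolyC M c) = wconst c.
Proof. exact: mmapC. Qed.

Lemma wickpolyXU k : wickpoly (mpolyX K (mnm1 k)) = Hbasis K [mset (k : nat)]%mset.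
Proof. by rewrite /wickpoly mmapX mmap1U. Qed.

Lemma Hbasis_msetn n (k : nat) : Hbasis K (msetn n k) = Hbasis K [mset k]%mset ^+ n.
Proof.
elim: n => [|n IHn]; first by rewrite msetn0.
rewrite exprS -IHn HbasisM; congr Hbasis; apply/msetP => j.
by rewrite msetE2 !msetnE; case: eqP.
Qed.

Lemma wickpolyX m : wickpoly (mpolyX K m) = Hbasis K (ellof m).
Proof.
rewrite /wickpoly mmapX /mmap1 /ellof (big_morph (Hbasis K) (id1 := 1) (op1 := *%R))//.
  by apply: eq_bigr => k _; rewrite -Hbasis_msetn.
by move=> a b; rewrite HbasisM.
Qed.

Lemma wickpoly_coef p a :
  wickpoly p a = \sum_(m <- msupp p) mcoeff m p * (a == ellof m)%:R.
Proof.
rewrite {1}[p]mpolyE raddf_sum fseries_sum; apply: eq_bigr => m _ /=.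
by rewrite -mul_mpolyC rmorphM /= wickpolyC wickpolyX wconst_mulE.
Qed.

Lemma wickpoly_confined p : confined M (wickpoly p).
Proof.
move=> a k Mk ak; rewrite wickpoly_coef big1// => m _.
case: eqP => [am|_]; last by rewrite mulr0.
by move: ak; rewrite am ellof_out ?eqxx.
Qed.

Lemma wickpoly_order n p :
  (forall m, (mdeg m < n)%N -> mcoeff m p = 0) -> order_ge M n (wickpoly p).
Proof.
move=> pn a an; rewrite wickpoly_coef big1// => m _.
case: eqP => [am|_]; last by rewrite mulr0.
by rewrite pn ?mul0r// mdegE -mdegree_ellof -am.
Qed.

Definition truncated n T : mpoly M K :=
  \sum_(m : bmultinom M n) T (ellof (bmnm m)) *: mpolyX K (bmnm m).

Lemma wickpoly_truncated n T : confined M T ->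
  order_ge M n (T - wickpoly (truncated n T)).
Proof.
move=> TM a an; rewrite fseriesB raddf_sum fseries_sum.
have wE (m : bmultinom M n) : wickpoly (T (ellof (bmnm m)) *: mpolyX K (bmnm m)) a =
    T (ellof (bmnm m)) * (a == ellof (bmnm m))%:R.
  by rewrite -mul_mpolyC rmorphM /= wickpolyC wickpolyX wconst_mulE.
rewrite (eq_bigr _ (fun m _ => wE m)).
have [[k Mk ak]|aM] := pselect (exists2 k, (M <= k)%N & a k != 0%N).
  rewrite (TM a k)// big1 ?subr0// => m _; case: eqP => [am|_]; last by rewrite mulr0.
  by move: ak; rewrite am ellof_out ?eqxx.
(* Now [a] lives on the first [M] positions and is one of the exponents kept by the truncation. *)
have a0 k : (M <= k)%N -> a k = 0%N.
  by move=> Mk; apply: contra_notP aM => /eqP ak; exists k.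
have an' : (mdeg (Multinom [tuple a (k : nat) | k < M]) < n)%N.
  by rewrite mdegE (eq_bigr (fun k : 'I_M => a k))// => k _; rewrite mnmE.
have aE : ellof (Multinom [tuple a (k : nat) | k < M]) = a.
  by rewrite -[RHS](ellofK a0); congr ellof; apply/funext => k; rewrite mnmE.
rewrite (bigD1 (BMultinom an'))//= aE eqxx mulr1 big1 ?addr0 ?subrr// => m mm.
case: eqP => [am|_]; last by rewrite mulr0.
case/eqP: mm; apply/val_inj => /=; apply/mnmP => k.
by rewrite mnmE am ellof_ord.
Qed.

End PolynomialSeries.

(** * Expansions in base [n] *)

Section Digits.
Variable n : nat.

Lemma digits_lt M (f : 'I_M -> nat) :
  (forall k, (f k < n)%N) -> (\sum_(k < M) f k * n ^ k < n ^ M)%N.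
Proof.
elim: M f => [|M IHM] f fn; first by rewrite big_ord0.
rewrite big_ord_recr /= expnSr.
have := IHM (fun k => f (widen_ord (leqnSn M) k)) (fun k => fn _).
move: (fn ord_max); set x := f _; set s := (\sum_(i < M) _)%N => xn sM.
by apply: leq_trans (leq_mul (leqnn (n ^ M)) xn); rewrite mulnS mulnC ltn_add2r.
Qed.

(** The lowest digit is the remainder modulo [n]; the others follow by induction after division by
    [n]. *)
Lemma digits_inj M (f g : 'I_M -> nat) :
  (forall k, (f k < n)%N) -> (forall k, (g k < n)%N) ->
  (\sum_(k < M) f k * n ^ k = \sum_(k < M) g k * n ^ k)%N -> f =1 g.
Proof.
elim: M f g => [|M IHM] f g fn gn; first by move=> _ [].
have E (h : 'I_M.+1 -> nat) : (\sum_(k < M.+1) h k * n ^ k =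
    (\sum_(k < M) h (lift ord0 k) * n ^ k) * n + h ord0)%N.
  rewrite big_ord_recl expn0 muln1 addnC big_distrl /=; congr addn.
  by apply: eq_bigr => k _; rewrite /bump /= expnSr mulnA.
rewrite !E => H; have n0 : (0 < n)%N by apply: leq_ltn_trans (fn ord0).
have H0 : f ord0 = g ord0.
  by move/(congr1 (modn^~ n)): H; rewrite !modnMDl !modn_small.
have H1 : (\sum_(k < M) f (lift ord0 k) * n ^ k =
           \sum_(k < M) g (lift ord0 k) * n ^ k)%N.
  by apply/eqP; rewrite -(eqn_pmul2r n0) -(eqn_add2r (f ord0)) H H0.
move=> k; case: (unliftP ord0 k) => [j|] -> //.
by apply: (IHM (fun k => f (lift ord0 k)) (fun k => g (lift ord0 k))).
Qed.

End Digits.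

(** * Polynomials that are O(t^n) near the origin *)

Section SmallPolynomials.
Variable K : numFieldType.

(** A nonzero [c] is refuted by the single value t = d|c| / (|c| + dS), which lies in (0, d] and
    makes t S smaller than |c|. *)
Lemma le_small_eq0 (c S d : K) : 0 < d -> 0 <= S ->
  (forall t : K, 0 < t -> t <= d -> `|c| <= t * S) -> c = 0.
Proof.
move=> d0 S0 H; apply: contrapT => /eqP c0.
have {}c0 : 0 < `|c| by rewrite normr_gt0.
have dS : 0 <= d * S by rewrite mulr_ge0// ltW.
have D0 : 0 < `|c| + d * S by rewrite ltr_wpDr.
have /H : 0 < d * (`|c| / (`|c| + d * S)) by rewrite mulr_gt0// divr_gt0.
rewrite ler_piMr ?(ltW d0)//; last by rewrite ler_pdivrMr// mul1r lerDl.
move=> /(_ isT); rewrite mulrAC mulrA ler_pdivlMr// mulrC.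
by rewrite ler_pM2r// gerDr lt_geF.
Qed.

(* Along the curve z_k = t^(L + n^k), with L = n^M, the monomial z^m becomes
   t^(|m| L + code m), where code m < L reads off the entries of m in base n:
   monomials of degree < n get distinct exponents, all smaller than n L. *)
Lemma small_mpoly_coef M (p : mpoly M K) n (S e : K) : 0 < e -> 0 <= S ->
  (forall (t : K) (z : 'I_M -> K), 0 < t -> t <= e -> (forall k, `|z k| <= t) ->
    `|meval z p| <= S * t ^+ n) ->
  forall m, (mdeg m < n)%N -> mcoeff m p = 0.
Proof.
move=> e0 S0 psmall.
pose L := (n ^ M)%N; pose code (m : multinom M) := (\sum_(k < M) m k * n ^ k)%N.
pose wt (m : multinom M) := (mdeg m * L + code m)%N.
have entry_lt (m : multinom M) k : (mdeg m < n)%N -> (m k < n)%N.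
  by apply: leq_ltn_trans; rewrite mdegE (bigD1 k)//= leq_addr.
have code_lt (m : multinom M) : (mdeg m < n)%N -> (code m < L)%N.
  by move=> mn; apply: digits_lt => k; exact: entry_lt.
have wt_lt (m : multinom M) : (mdeg m < n)%N -> (wt m < n * L)%N.
  move=> mn; apply: leq_trans (leq_mul mn (leqnn L)).
  by rewrite /wt mulSn addnC ltn_add2r code_lt.
have wt_inj (m m' : multinom M) :
    (mdeg m < n)%N -> (mdeg m' < n)%N -> wt m = wt m' -> m = m'.
  move=> mn m'n E; apply/mnmP; apply: (@digits_inj n) => [k|k|].
  - exact: entry_lt.
  - exact: entry_lt.
  move/(congr1 (modn^~ L)): E.
  by rewrite !modnMDl !modn_small//; exact: code_lt.
suff H w m : (mdeg m < n)%N -> wt m = w -> mcoeff m p = 0.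
  by move=> m mn; exact: (H (wt m)).
(* Monomials of degree below [n] are eliminated in order of increasing weight, that is, of
   increasing power of [t] along the curve. *)
elim/ltn_ind: w m => w IH m mn mw.
have n0 : (0 < n)%N by apply: leq_ltn_trans mn.
have L0 : (0 < L)%N by rewrite expn_gt0 n0.
(* Degree below [n]: lighter monomials vanish by induction and equal weight means equality. Degree
   at least [n]: the weight is at least n L, hence above [w]. *)
have heavy m' : m' \in msupp p -> m' != m -> (w < wt m')%N.
  rewrite mcoeff_msupp => pm' m'm; have [m'n|nm'] := ltnP (mdeg m') n.
    rewrite ltn_neqAle; apply/andP; split.
      by apply: contraNneq m'm => E; apply/eqP/wt_inj => //; rewrite mw E.
    by rewrite leqNgt; apply: contraNN pm' => /IH/(_ m' m'n erefl) ->.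
  rewrite -mw; apply: leq_trans (wt_lt m mn) _.
  by rewrite /wt (leq_trans _ (leq_addr _ _))// leq_mul2r nm' orbT.
pose Sp := \sum_(m' <- msupp p | m' != m) `|mcoeff m' p|.
have Sp0 : 0 <= Sp by apply: sumr_ge0.
(* e / (1 + e) lies below both 1 and [e]. *)
have d0 : 0 < e / (1 + e) by rewrite divr_gt0// addr_gt0.
apply: (@le_small_eq0 _ (S + Sp) _ d0); first exact: addr_ge0.
move=> t t0 td.
have t1 : t <= 1 by apply: le_trans td _; rewrite ler_pdivrMr ?addr_gt0// mul1r lerDr.
have te : t <= e.
  by apply: le_trans td _; rewrite ler_pdivrMr ?addr_gt0// ler_peMr ?(ltW e0)// lerDl (ltW e0).
have tle i j : (i <= j)%N -> t ^+ j <= t ^+ i by move=> ij; apply: ler_wiXn2l => //; exact: ltW.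
pose z (k : 'I_M) := t ^+ (L + n ^ k).
have zM m' : \prod_k z k ^+ (m' : multinom M) k = t ^+ wt m'.
  rewrite (eq_bigr (fun k => t ^+ (m' k * L + m' k * n ^ k))); last first.
    by move=> k _; rewrite /z -exprM mulnC mulnDr.
  rewrite -(@big_morph _ _ (GRing.exp t) 1 *%R 0%N addn (exprD t) erefl).
  by rewrite big_split /= -big_distrl /= /wt mdegE.
have : `|meval z p| <= S * t ^+ w.+1.
  (* All coordinates of the curve are at most t^L, so the hypothesis is applied with t^L in place of
     [t]; n L > w gives the power w + 1. *)
  apply: (@le_trans _ _ (S * (t ^+ L) ^+ n)).
    apply: psmall; first exact: exprn_gt0.
      by apply: le_trans te; rewrite -[leRHS]expr1 tle.
    by move=> k; rewrite ger0_norm ?tle ?leq_addr// exprn_ge0// ltW.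
  by rewrite ler_wpM2l// -exprM tle// mulnC -mw wt_lt.
have pz : meval z p = mcoeff m p * t ^+ w +
    \sum_(m' <- msupp p | m' != m) mcoeff m' p * t ^+ wt m'.
  rewrite mevalE (eq_bigr _ (fun m' _ => congr1 (GRing.mul _) (zM m'))).
  have [mp|mp] := boolP (m \in msupp p).
    by rewrite (bigD1_seq m)//= mw.
  rewrite (memN_msupp_eq0 mp) mul0r add0r big_seq_cond [RHS]big_seq_cond.
  by apply: eq_bigl => m'; have [->|] := eqVneq m' m; rewrite ?(negbTE mp) ?andbT.
have Sm : `|\sum_(m' <- msupp p | m' != m) mcoeff m' p * t ^+ wt m'| <= Sp * t ^+ w.+1.
  apply: le_trans (ler_norm_sum _ _ _) _; rewrite mulr_suml.
  rewrite big_seq_cond [leRHS]big_seq_cond; apply: ler_sum => m' /andP[m'p m'm].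
  by rewrite normrM ler_wpM2l// ger0_norm ?exprn_ge0 ?(ltW t0)// tle// heavy.
(* Multiplied by t^w, the goal bounds the term of [m], which is p(z) minus the heavier terms. *)
move=> pS; rewrite -(ler_pM2r (exprn_gt0 w t0)) mulrAC -exprS mulrDr.
rewrite -[X in _ * X](ger0_norm (exprn_ge0 w (ltW t0))) -normrM.
rewrite -[X in `|X|](addrK (\sum_(m' <- msupp p | m' != m) mcoeff m' p * t ^+ wt m')) -pz.
by apply: le_trans (ler_normB _ _) _; rewrite lerD// mulrC.
Qed.

End SmallPolynomials.

(** * Estimates for Taylor series at the origin *)

Section TaylorBounds.
Variable K : numFieldType.

#[local] Existing Instance totally_filter.

Lemma near0_rowP M (P : 'rV[K]_M -> Prop) :
  (\forall z \near (0 : 'rV[K]_M), P z)%classic <->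
  exists2 e : K, 0 < e & forall z : 'rV[K]_M, (forall k, `|z ord0 k| < e) -> P z.
Proof.
split=> [/nbhs_ballP[e /= e0 eP]|[e e0 eP]].
  exists e => // z ze; apply: eP; split=> // i j; rewrite ord1 mxE.
  by rewrite /ball /= sub0r normrN.
apply/nbhs_ballP; exists e => //= z ze; apply: eP => k.
by have := ze.2 ord0 k; rewrite mxE /ball /= sub0r normrN.
Qed.

Lemma partial_sum_fset (I : choiceType) (x : I -> K) (A : {fset I}) :
  partial_sum x A = \sum_(a <- A) x a.
Proof. by rewrite /partial_sum big_seq_fsetE. Qed.

(** Beyond some finite [A] all partial sums are within 1 of [l], so adjoining one index changes them
    by at most 2; terms inside [A] are bounded by the sum of their moduli. *)
Lemma cvg_partial_sum_bounded (I : choiceType) (x : I -> K) (l : K) :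
  (partial_sum x @ totally --> l)%classic ->
  exists2 S, 0 <= S & forall a, `|x a| <= S.
Proof.
move=> /cvgrPdist_lt /(_ 1 ltr01)[A _ Al].
have S0 : 0 <= \sum_(a <- A) `|x a| by apply: sumr_ge0.
exists (2 + \sum_(a <- A) `|x a|); first exact: addr_ge0.
move=> a; have [aA|aA] := boolP (a \in A).
  by rewrite (big_rem a aA)/= addrCA lerDl addr_ge0//; apply: sumr_ge0.
apply: ler_wpDr => //.
have := Al _ (fsubsetUr [fset a]%fset A); have := Al _ (fsubset_refl A).
rewrite /= !partial_sum_fset big_fsetU1//= => lA laA.
have -> : x a = l - \sum_(i <- A) x i - (l - (x a + \sum_(i <- A) x i)).
  by rewrite opprB addrC addrA subrK addrK.
by rewrite (le_trans (ler_normB _ _))// (natrD _ 1 1) lerD// ltW.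
Qed.

Variable M : nat.
Implicit Types (z : 'rV[K]_M) (g : 'rV[K]_M -> K) (T : zseries K).

Lemma monomial_at_ellof z (m : multinom M) :
  monomial_at z (ellof m) = meval (z ord0) (mpolyX K m).
Proof. by rewrite mevalX; apply: eq_bigr => k _; rewrite ellof_ord. Qed.

Lemma norm_monomial_at_le z (t : K) (a : ell) :
  (forall k, `|z ord0 k| <= t) -> `|monomial_at z a| <= t ^+ mdegree M a.
Proof.
move=> zt; rewrite normr_prod /mdegree.
rewrite (@big_morph _ _ (GRing.exp t) 1 *%R 0%N addn (exprD t) erefl).
by apply: ler_prod => k _; rewrite normr_ge0 normrX lerXn2r ?nnegrE// (le_trans _ (zt k)).
Qed.

Lemma monomial_at_const (t : K) (a : ell) :
  monomial_at (const_mx t : 'rV_M) a = t ^+ mdegree M a.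
Proof.
rewrite /mdegree (@big_morph _ _ (GRing.exp t) 1 *%R 0%N addn (exprD t) erefl).
by apply: eq_bigr => k _; rewrite mxE.
Qed.

(** The series converges at the point whose coordinates all equal half the radius, so its terms
    there are bounded. Halving also turns strict bounds on [z] into weak ones. *)
Lemma taylor_bound g T : taylor g 0 T -> exists S e : K,
  [/\ 0 <= S, 0 < e, forall a, `|T a| * e ^+ mdegree M a <= S &
   forall z, (forall k, `|z ord0 k| <= e) ->
    (partial_sum (fun a => T a * monomial_at z a) @ totally --> g z)%classic].
Proof.
move=> [TM /near0_rowP[e e0 eT]].
have e20 : 0 < e / 2 by rewrite divr_gt0.
have cvgT z : (forall k, `|z ord0 k| <= e / 2) ->
    (partial_sum (fun a => T a * monomial_at z a) @ totally --> g z)%classic.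
  move=> ze; have := eT z; rewrite subr0; apply => k.
  by apply: le_lt_trans (ze k) _; rewrite ltr_pdivrMr// ltr_pMr// (ltr_nat _ 1 2).
have /cvgT/cvg_partial_sum_bounded[S S0 TS] :
    forall k, `|(const_mx (e / 2) : 'rV[K]_M) ord0 k| <= e / 2.
  by move=> k; rewrite mxE ger0_norm// ltW.
exists S, (e / 2); split => // a; have := TS a.
by rewrite monomial_at_const normrM normrX (ger0_norm (ltW e20)).
Qed.

(** Taylor remainder: for |a| >= n a term is at most S (t/e)^|a| = S (2t/e)^|a| 2^(-|a|). Since 2t/e
    <= 1, the first power is at most (2t/e)^n; summing the second gives 2^M. *)
Lemma taylor_truncated g T n : taylor g 0 T -> exists S e : K,
  [/\ 0 <= S, 0 < e & forall (t : K) z, 0 < t -> t <= e ->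
   (forall k, `|z ord0 k| <= t) ->
   `|g z - meval (z ord0) (truncated M n T)| <= S * t ^+ n].
Proof.
move=> gT; have [S [e [S0 e0 TS cvgT]]] := taylor_bound gT.
have TM := gT.1.
have e20 : 0 < e / 2 by rewrite divr_gt0.
exists (S * (2 / e) ^+ n * 2 ^+ M), (e / 2).
split => //; first by rewrite !mulr_ge0 ?exprn_ge0 ?divr_ge0 ?(ltW e0).
move=> t z t0 te zt.
have te' : t <= e.
  by apply: le_trans te _; rewrite ler_pdivrMr// ler_pMr// (ler_nat _ 1 2).
have {}cvgT := cvgT z (fun k => le_trans (zt k) te').
pose F a := T a * monomial_at z a.
pose B := [seq ellof (bmnm m) | m <- enum {: bmultinom M n}].
have uB : uniq B.
  rewrite map_inj_uniq ?enum_uniq// => m m' mm'.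
  by apply/val_inj/mnmP => k; have := congr1 (fun a : ell => a k) mm'; rewrite !ellof_ord.
have sumB (A : {fset ell}) : {subset B <= A} ->
    \sum_(a <- A | a \in B) F a = meval (z ord0) (truncated M n T).
  move=> BA; rewrite -big_filter (perm_big B); last first.
    apply: uniq_perm => //; first exact/filter_uniq/fset_uniq.
    by move=> a; rewrite mem_filter andb_idr// => /BA.
  rewrite big_map big_enum raddf_sum; apply: eq_bigr => m _ /=.
  by rewrite mevalZ -monomial_at_ellof.
have high a : a \notin B -> `|F a| <= S * (2 / e) ^+ n * t ^+ n * 2^-1 ^+ mdegree M a.
  move=> aB; have R0 : 0 <= S * (2 / e) ^+ n * t ^+ n * 2^-1 ^+ mdegree M a.
    by rewrite !mulr_ge0 ?exprn_ge0 ?divr_ge0 ?invr_ge0 ?(ltW e0) ?(ltW t0).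
  have [aE|/(confined_eq0 TM) Ta0] := eqVneq a (ellof (fun k : 'I_M => a k)); last first.
    by rewrite /F Ta0 mul0r normr0.
  have na : (n <= mdegree M a)%N.
    rewrite leqNgt; apply: contra aB => an.
    have an' : (mdeg (Multinom [tuple a (k : nat) | k < M]) < n)%N.
      by rewrite mdegE (eq_bigr (fun k : 'I_M => a k))// => k _; rewrite mnmE.
    apply/mapP; exists (BMultinom an'); first by rewrite mem_enum.
    by rewrite {1}aE; congr ellof; apply/funext => k; rewrite mnmE.
  rewrite normrM; apply: (@le_trans _ _ (S * (t / e) ^+ mdegree M a)).
    rewrite expr_div_n mulrA.
    rewrite ler_pdivlMr ?exprn_gt0// mulrAC.
    apply: ler_pM => //; first exact: mulr_ge0 (exprn_ge0 _ (ltW e0)).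
    exact: norm_monomial_at_le.
  rewrite -!mulrA ler_wpM2l// mulrA -exprMn.
  have -> : t / e = (2 / e * t) * 2^-1.
    by rewrite [RHS]mulrC !mulrA mulVf ?pnatr_eq0// mul1r mulrC.
  rewrite [leLHS]exprMn ler_wpM2r ?exprn_ge0 ?invr_ge0//.
  apply: ler_wiXn2l => //; first by rewrite mulr_ge0 ?divr_ge0 ?(ltW e0) ?(ltW t0).
  by rewrite mulrC mulrA ler_pdivrMr// mul1r -ler_pdivlMr.
(* Up to an arbitrary error [d], [g z] is replaced by a finite sum whose index set contains [B]; its
   part over [B] is exactly the truncation. *)
apply/ler_addgt0Pr => d d0.
move/cvgrPdist_lt : cvgT => /(_ d d0)[A0 _ Al].
pose A := (A0 `|` [fset a in B])%fset.
have := Al A (fsubsetUl _ _); rewrite /= partial_sum_fset => gA.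
have BA : {subset B <= A} by move=> a aB; rewrite !inE aB orbT.
rewrite -(subrK (\sum_(a <- A) F a) (g z)) -addrA (le_trans (ler_normD _ _))// [leLHS]addrC.
apply: lerD; last exact: ltW.
rewrite (bigID (mem B))/= (sumB _ BA) addrC addKr.
apply: le_trans (ler_norm_sum _ _ _) _.
rewrite mulrAC big_mkcond/=; apply: sum_confined_le.
- by rewrite !mulr_ge0 ?exprn_ge0 ?divr_ge0 ?(ltW e0) ?(ltW t0).
- by move=> a k Mk ak; case: ifP => // _; rewrite /F (TM a k)// mul0r normr0.
- move=> a; case: ifPn => [/high//|_].
  by rewrite !mulr_ge0 ?exprn_ge0 ?divr_ge0 ?invr_ge0 ?(ltW e0) ?(ltW t0).
Qed.

End TaylorBounds.

(** * From values near the origin to identities of formal series *)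

Section RationalGerms.
Variables (K : numFieldType) (M : nat).
Implicit Types (p d P : mpoly M K) (g : 'rV[K]_M -> K) (T : zseries K).

Lemma meval_order_le p n (t : K) (z : 'I_M -> K) :
  (forall m, (mdeg m < n)%N -> mcoeff m p = 0) ->
  0 <= t -> t <= 1 -> (forall k, `|z k| <= t) ->
  `|meval z p| <= (\sum_(m <- msupp p) `|mcoeff m p|) * t ^+ n.
Proof.
move=> pn t0 t1 zt; rewrite mevalE mulr_suml (le_trans (ler_norm_sum _ _ _))//.
rewrite big_seq [leRHS]big_seq; apply: ler_sum => m mp.
have nm : (n <= mdeg m)%N.
  by rewrite leqNgt; apply: contraTN mp => /pn m0; rewrite mcoeff_msupp m0 eqxx.
rewrite normrM ler_wpM2l// (le_trans _ (ler_wiXn2l _ _ nm))//.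
rewrite normr_prod mdegE (@big_morph _ _ (GRing.exp t) 1 *%R 0%N addn (exprD t) erefl).
by apply: ler_prod => k _; rewrite normr_ge0 normrX lerXn2r ?nnegrE// zt.
Qed.

(** Write d = c + r with r(0) = 0; within radius t = |c| / (|c| + S) one has |r(z)| <= S t < |c|. *)
Lemma meval_near0_neq0 d : mcoeff mnm0 d != 0 ->
  (\forall z \near (0 : 'rV[K]_M), meval ((z : 'rV[K]_M) ord0) d != 0)%classic.
Proof.
set c := mcoeff _ d => c0; pose r := d - mpolyC M c.
have r0 m : (mdeg m < 1)%N -> mcoeff m r = 0.
  by rewrite ltnS leqn0 mdeg_eq0 => /eqP ->; rewrite mcoeffB mcoeffC eqxx mulr1 subrr.
set S := \sum_(m <- msupp r) `|mcoeff m r|.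
have S0 : 0 <= S by apply: sumr_ge0.
have c0' : 0 < `|c| by rewrite normr_gt0.
have D0 : 0 < `|c| + S by rewrite ltr_wpDr.
apply/near0_rowP; exists (`|c| / (`|c| + S)) => [|z ze]; first exact: divr_gt0.
have [S_eq0|S_neq0] := eqVneq S 0.
  have rz : meval (z ord0) r = 0.
    rewrite mevalE big_seq big1// => m mr; apply/eqP; rewrite mulf_eq0.
    have /eqP := S_eq0; rewrite psumr_eq0// => /allP/(_ _ mr) /=.
    by rewrite normr_eq0 => ->.
  by have := mevalB (z ord0) d (mpolyC M c); rewrite -/r rz mevalC => /esym/eqP; rewrite subr_eq0 => /eqP ->.
have Sp : 0 < S by rewrite lt_def S_neq0.
have t1 : `|c| / (`|c| + S) <= 1 by rewrite ler_pdivrMr// mul1r lerDl.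
have := meval_order_le r0 (ltW (divr_gt0 c0' D0)) t1 (fun k => ltW (ze k)).
rewrite -/S expr1 => rS.
have {}rS : `|meval (z ord0) r| < `|c|.
  apply: le_lt_trans rS _; rewrite mulrA ltr_pdivrMr// mulrC ltr_pM2l//.
  by rewrite ltrDr.
apply: contraTneq rS => dz.
by rewrite /r mevalB dz mevalC sub0r normrN ltxx.
Qed.

Lemma rational_germ_near x g P d : rational_germ x g ->
  x = tofrac P / tofrac d -> mcoeff mnm0 d != 0 ->
  (\forall z \near (0 : 'rV[K]_M), meval ((z : 'rV[K]_M) ord0) d * g z = meval (z ord0) P)%classic.
Proof.
move=> xg xE /meval_near0_neq0; apply: filterS2 xg => z xg dz.
have /xg -> : rvalue x z (meval (z ord0) P / meval (z ord0) d) by exists P, d.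
by rewrite mulrC divfK.
Qed.

(** Modulo order [n], [T] may be replaced by its truncation T_n. Near 0, d T_n - P = d (T_n - g) is
    O(t^n), and a polynomial that small has no terms of degree below [n]. *)
Lemma taylor_wickpoly_mul g T P d : taylor g 0 T ->
  (\forall z \near (0 : 'rV[K]_M), meval ((z : 'rV[K]_M) ord0) d * g z = meval (z ord0) P)%classic ->
  wickpoly d * T = wickpoly P.
Proof.
move=> gT /near0_rowP[e1 e10 dgP]; apply: (order_ge_eq (M := M)) => n.
have -> : wickpoly d * T - wickpoly P = wickpoly d * (T - wickpoly (truncated M n T)) +
    wickpoly (d * truncated M n T - P).
  by rewrite mulrBr rmorphB rmorphM addrA subrK.
apply: order_geD; first by apply: order_geMl; exact: wickpoly_truncated gT.1.
apply: wickpoly_order; have [S [e [S0 e0 gS]]] := taylor_truncated n gT.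
set D := \sum_(m <- msupp d) `|mcoeff m d|.
have D0 : 0 <= D by apply: sumr_ge0.
(* At most 1 and [e], and strictly below [e1]: the ranges of the bound on [d], of the remainder
   estimate and of d g = P. *)
pose q := (1 + e^-1 + 2 / e1)^-1.
have q0 : 0 < q by rewrite invr_gt0 !addr_gt0 ?invr_gt0// divr_gt0.
have q1 : q <= 1.
  by rewrite invf_le1 ?addr_gt0 ?invr_gt0 ?divr_gt0// -addrA lerDl addr_ge0 ?invr_ge0 ?divr_ge0 ?ltW.
have qe : q <= e.
  rewrite -[e]invrK lef_pV2 ?posrE ?addr_gt0 ?invr_gt0 ?divr_gt0//.
  by rewrite addrAC lerDr addr_ge0 ?divr_ge0 ?ltW.
have qe1 : q < e1.
  rewrite -[e1]invrK ltf_pV2 ?posrE ?addr_gt0 ?invr_gt0 ?divr_gt0//.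
  rewrite ltr_wpDl ?addr_ge0 ?invr_ge0 ?ltW//.
  by rewrite mulr_natl mulr2n ltrDl invr_gt0.
apply: (small_mpoly_coef q0 (mulr_ge0 D0 S0)) => t z t0 tq zt.
pose zr : 'rV[K]_M := \row_k z k.
have zE p : meval z p = meval (zr ord0) p by apply: meval_eq => k; rewrite mxE.
have zrt k : `|zr ord0 k| <= t by rewrite mxE.
rewrite zE mevalB mevalM -dgP; last by move=> k; apply: le_lt_trans (zrt k) (le_lt_trans tq qe1).
rewrite -mulrBr normrM -mulrA ler_pM//.
  (* Order 0 and radius 1 give |d(z)| <= [D]. *)
  have := @meval_order_le d 0 1 (zr ord0) _ ler01 (lexx _).
  rewrite expr0 mulr1; apply => // k.
  by rewrite (le_trans (zrt k)) ?(le_trans tq).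
by rewrite distrC gS// (le_trans tq).
Qed.

End RationalGerms.

(** * Kondratiev norms of series with exponentially bounded coefficients *)

Section KondratievBounds.
Variables (R : realType) (M : nat).
Local Notation C := R[i].
Local Notation toC := (real_complex R).
Implicit Types u : fseries C.

Lemma kweight_ge0 r (a : ell) : 0 <= kweight R r a.
Proof. by apply: prodr_ge0 => k _; rewrite invr_ge0 exprn_ge0. Qed.

(** Every base 2 (k + 1) is at least 2, and the factors at positions from [M] on are at most 1. *)
Lemma kweight_le r (a : ell) : kweight R r a <= (2^-1 ^+ r) ^+ mdegree M a.
Proof.
rewrite /kweight /mdegree.
have h k : (2 * k.+1)%:R ^- (r * a k) <= (2^-1 ^+ r) ^+ a k :> R.
  rewrite -exprM exprVn lef_pV2 ?posrE ?exprn_gt0// lerXn2r ?nnegrE//.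
  by rewrite ler_nat leq_pmulr.
have h1 k : (2 * k.+1)%:R ^- (r * a k) <= 1 :> R.
  by apply: le_trans (h k) _; rewrite !exprn_ile1 ?exprn_ge0// invf_le1// (ler_nat _ 1).
have h0 k : 0 <= (2 * k.+1)%:R ^- (r * a k) :> R by rewrite invr_ge0 exprn_ge0.
rewrite (bigID (fun k => (k < M)%N))/= [leRHS](_ : _ = 1 * \prod_(k < M) (2^-1 ^+ r) ^+ a k); last first.
  by rewrite mul1r (@big_morph _ _ (GRing.exp (2^-1 ^+ r : R)) 1 *%R 0%N addn (exprD _) erefl).
rewrite mulrC; apply: ler_pM; try by apply: prodr_ge0.
  apply: (@le_trans _ _ (\prod_(k <- finsupp a | ~~ (k < M)%N) 1)); last by rewrite big1.
  by apply: ler_prod => k _; rewrite h0 h1.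
apply: (@le_trans _ _ (\prod_(k < M) (2 * (k : nat).+1)%:R ^- (r * a k))); last first.
  by apply: ler_prod => k _; rewrite h0 h.
rewrite [leLHS](_ : _ = \prod_(0 <= k < M | k \in finsupp a) (2 * k.+1)%:R ^- (r * a k)).
  (* Positions outside the support have exponent 0, so the product may run over all k < M. *)
  rewrite big_mkord big_mkcond/=; apply: ler_prod => k _.
  by rewrite mem_finsupp; case: eqP => [->|_] /=; rewrite ?muln0 ?expr0 ?invr1 ?ler01 ?lexx ?h0.
rewrite -big_filter -[RHS]big_filter; apply: perm_big; apply: uniq_perm.
- exact/filter_uniq/fset_uniq.
- exact/filter_uniq/iota_uniq.
- by move=> k; rewrite !mem_filter mem_index_iota leq0n andbC.
Qed.

Lemma knorm2_ge0 r u : (0 <= knorm2 r u)%E.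
Proof.
apply: esum_ge0 => a _; rewrite lee_fin mulr_ge0 ?kweight_ge0//.
have : 0 <= `|u a| ^+ 2 by rewrite exprn_ge0.
by rewrite lecE => /andP[].
Qed.

(* As kweight r a <= 2^(-r |a|), each term is at most S^2 4^(-|a|); one factor
   2^(-|a|) yields 2^(-n) and the other is summed over all a. *)
Lemma knorm2_le r n u (S B : R) : 0 <= S -> 0 <= B -> 4 * B ^+ 2 <= 2 ^+ r ->
  confined M u -> order_ge M n u ->
  (forall a, `|u a| <= toC (S * B ^+ mdegree M a)) ->
  (knorm2 r u <= (S ^+ 2 * 2 ^+ M * 2^-1 ^+ n)%:E)%E.
Proof.
move=> S0 B0 Br uM un uS; pose w a := complex.Re (`|u a| ^+ 2) * kweight R r a.
have w0 a : u a = 0 -> w a = 0 by move=> ua; rewrite /w ua normr0 expr0n /= mul0r.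
have wS a : w a <= S ^+ 2 * 2^-1 ^+ n * 2^-1 ^+ mdegree M a.
  have [an|na] := ltnP (mdegree M a) n.
    by rewrite w0 ?un// !mulr_ge0 ?exprn_ge0 ?invr_ge0.
  apply: (@le_trans _ _ ((S * B ^+ mdegree M a) ^+ 2 * (2^-1 ^+ r) ^+ mdegree M a)).
    have : `|u a| ^+ 2 <= toC ((S * B ^+ mdegree M a) ^+ 2).
      by rewrite rmorphXn lerXn2r ?nnegrE// (le_trans _ (uS a)).
    rewrite lecE => /andP[_ ule]; apply: ler_pM => //; last exact: kweight_le.
      have : 0 <= `|u a| ^+ 2 by rewrite exprn_ge0.
      by rewrite lecE => /andP[].
    exact: kweight_ge0.
  rewrite exprMn -[leLHS]mulrA -[leRHS]mulrA ler_wpM2l ?exprn_ge0//.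
  (* By [Br], B^2 2^(-r) is at most 1/4, split here as 1/2 times 1/2. *)
  apply: (@le_trans _ _ (2^-1 ^+ mdegree M a * 2^-1 ^+ mdegree M a)); last first.
    rewrite ler_wpM2r ?exprn_ge0 ?invr_ge0//.
    by apply: ler_wiXn2l => //; rewrite ?invr_ge0// invf_le1// (ler_nat _ 1).
  rewrite (exprAC B) -!exprMn.
  rewrite lerXn2r ?nnegrE ?mulr_ge0 ?exprn_ge0 ?invr_ge0//.
  rewrite exprVn ler_pdivrMr ?exprn_gt0// -invfM mulrC ler_pdivlMr// mulrC.
  by rewrite -natrM.
(* The [esum] is a supremum over finite index sets, so a uniform bound on finite sums suffices. *)
apply: ge_ereal_sup => _ [X [finX _] <-].
rewrite fsbig_finite//= sumEFin lee_fin mulrAC; apply: sum_confined_le => //.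
  by rewrite !mulr_ge0 ?exprn_ge0 ?invr_ge0.
by move=> a k Mk ak; exact: w0 (uM a k Mk ak).
Qed.

Lemma exp2_ge (x : R) : exists r, x <= 2 ^+ r.
Proof.
exists (Num.bound `|x|); apply: le_trans (ler_norm x) _.
apply: le_trans (ltW (archi_boundP (normr_ge0 x))) _.
by rewrite -natrX ler_nat ltnW// ltn_expl.
Qed.

(** Exponential growth in the degree is absorbed by any [r] with 4 B^2 <= 2^r. *)
Lemma kondratiev_bounded u (S B : R) : 0 <= S -> 0 <= B -> confined M u ->
  (forall a, `|u a| <= toC (S * B ^+ mdegree M a)) -> kondratiev u.
Proof.
move=> S0 B0 uM uS; have [r Br] := exp2_ge (4 * B ^+ 2); exists r.
by apply: le_lt_trans (knorm2_le S0 B0 Br uM (order_ge0 u) uS) _; rewrite ltry.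
Qed.

(** In the order of [R[i]] nonnegative elements are real; bounds found over [R[i]] thereby become
    real bounds. *)
Lemma toC_Re (x : C) : 0 <= x -> toC (complex.Re x) = x.
Proof. by case: x => x y; rewrite lecE /= => /andP[/eqP -> _]. Qed.

Lemma taylor_kondratiev (g : 'rV[C]_M -> C) T : taylor g 0 T -> kondratiev T.
Proof.
move=> gT; have [S [e [S0 e0 TS _]]] := taylor_bound gT.
have e10 : 0 <= e^-1 by rewrite invr_ge0 ltW.
have Re_ge0 (x : C) : 0 <= x -> 0 <= complex.Re x by rewrite lecE => /andP[].
apply: (@kondratiev_bounded _ (complex.Re S) (complex.Re e^-1)) => [|||a].
- exact: Re_ge0.
- exact: Re_ge0.
- exact: gT.1.
by rewrite rmorphM rmorphXn /= !toC_Re// exprVn ler_pdivlMr ?exprn_gt0.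
Qed.

End KondratievBounds.

(** * The formal Neumann series of sum_k H_(e_k) A_k *)

Section Neumann.
Variables (K : numFieldType) (M N : nat) (A : 'I_M -> 'M[K]_N).

Definition linseries (m n : nat) (B : 'I_M -> 'M[K]_(m, n)) : 'M[fseries K]_(m, n) :=
  \sum_(k < M) Hbasis K [mset (k : nat)]%mset *: map_mx (@wconst K) (B k).

Definition linpoly (m n : nat) (B : 'I_M -> 'M[K]_(m, n)) : 'M[mpoly M K]_(m, n) :=
  \sum_(k < M) mpolyX K (mnm1 k) *: map_mx (@mpolyC M K) (B k).

Lemma wickpoly_linpoly m n (B : 'I_M -> 'M[K]_(m, n)) :
  map_mx (@wickpoly K M) (linpoly B) = linseries B.
Proof.
apply/matrixP => i j; rewrite mxE !summxE raddf_sum; apply: eq_bigr => k _ /=.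
by rewrite !mxE rmorphM /= wickpolyXU wickpolyC.
Qed.

Local Notation G := (linseries A).

(** Summing over all rows gives one constant that dominates each row sum, as the induction on powers
    requires. *)
Definition linnorm : K := \sum_(i < N) \sum_(l < N) \sum_(k < M) `|A k i l|.

Lemma linnorm_ge0 : 0 <= linnorm.
Proof. by do 3![apply: sumr_ge0 => ? _]. Qed.

Lemma linseriesE i l : G i l = \sum_(k < M) Hbasis K [mset (k : nat)]%mset * wconst (A k i l).
Proof. by rewrite summxE; apply: eq_bigr => k _; rewrite !mxE. Qed.

(** Powers of [G] are images of polynomial matrices. *)
Lemma linseries_pow_confined n i j : confined M ((G ^+ n) i j).
Proof.
have [p ->] : exists p : 'M[mpoly M K]_N, G ^+ n = map_mx (@wickpoly K M) p.
  elim: n => [|n [p IHn]]; first by exists 1%:M; rewrite map_mx1.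
  by exists (linpoly A *m p); rewrite exprS IHn map_mxM wickpoly_linpoly.
by rewrite mxE; exact: wickpoly_confined.
Qed.

(** [G] has no constant term, so each factor raises the order by one. *)
Lemma linseries_pow_order n i j : order_ge M n ((G ^+ n) i j).
Proof.
elim: n i j => [|n IHn] i j //; rewrite exprS mxE.
apply: order_ge_sum => l _; rewrite -add1n; apply: order_geM; last exact: IHn.
rewrite linseriesE; apply: order_ge_sum => k _; rewrite mulrC; apply: order_geMl.
move=> a; rewrite ltnS leqn0 /Hbasis; case: (a =P [mset (k : nat)]%mset) => // -> /eqP.
by rewrite /mdegree (bigD1 k)//= msetnxx.
Qed.

(** Multiplication by a basis element only shifts coefficients, so a factor [G] enlarges a uniform
    coefficient bound at most by a row sum. *)
Lemma linseries_pow_bound n i j a : `|(G ^+ n) i j a| <= linnorm ^+ n.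
Proof.
elim: n i j a => [|n IHn] i j a.
  rewrite !expr0 mxE; case: (i == j); last by rewrite mulr0n normr0.
  by rewrite mulr1n -Hbasis0 /Hbasis; case: eqP => _; rewrite ?normr0 ?normr1.
rewrite !exprS mxE fseries_sum.
apply: (@le_trans _ _ ((\sum_(l < N) \sum_(k < M) `|A k i l|) * linnorm ^+ n)); last first.
  rewrite ler_wpM2r ?exprn_ge0 ?linnorm_ge0// /linnorm [leRHS](bigD1 i)//= lerDl.
  by do 3![apply: sumr_ge0 => ? _].
rewrite mulr_suml (le_trans (ler_norm_sum _ _ _))//; apply: ler_sum => l _.
rewrite linseriesE mulr_suml fseries_sum mulr_suml (le_trans (ler_norm_sum _ _ _))//.
apply: ler_sum => k _; rewrite -mulrA Hbasis_mulE; case: ifP => _; last first.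
  by rewrite normr0 mulr_ge0 ?exprn_ge0 ?linnorm_ge0.
by rewrite wconst_mulE normrM ler_wpM2l.
Qed.

Lemma neumann_partial_bound n i j a :
  `|(\sum_(k < n) G ^+ k) i j a| <= (1 + linnorm) ^+ n.
Proof.
rewrite summxE fseries_sum (le_trans (ler_norm_sum _ _ _))//.
apply: (@le_trans _ _ (\sum_(k < n) linnorm ^+ k)).
  by apply: ler_sum => k _; exact: linseries_pow_bound.
have c0 := linnorm_ge0; have c1 : 1 <= 1 + linnorm by rewrite lerDl.
(* With c = [linnorm], (1 + c)^(n+1) = (1 + c)^n + c (1 + c)^n, and the first summand is at least
   1. *)
elim: n => [|n IHn]; first by rewrite big_ord0.
rewrite big_ord_recl expr0 exprS mulrDl mul1r lerD ?exprn_ege1//.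
rewrite (eq_bigr (fun k : 'I_n => linnorm * linnorm ^+ k)); last by move=> k _; rewrite exprS.
by rewrite -mulr_sumr ler_wpM2l.
Qed.

(** The infinite sum of powers, finite at each index: G^k has order [k], so only k <= |a|
    contributes at [a]. *)
Definition neumann : 'M[fseries K]_N :=
  \matrix_(i, j) fun a => (\sum_(k < (mdegree M a).+1) G ^+ k) i j a.

Lemma neumann_confined i j : confined M (neumann i j).
Proof.
move=> a k Mk ak; rewrite mxE summxE fseries_sum big1// => n _.
exact: linseries_pow_confined ak.
Qed.

Lemma neumann_partial_confined n i j : confined M ((\sum_(k < n) G ^+ k) i j).
Proof.
move=> a k Mk ak; rewrite summxE fseries_sum big1// => l _.
exact: linseries_pow_confined ak.
Qed.

Lemma neumann_tail n i j :
  order_ge M n ((\sum_(k < n) G ^+ k) i j - neumann i j).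
Proof.
move=> a an; rewrite fseriesB mxE !summxE !fseries_sum.
rewrite -(big_mkord xpredT (fun k => (G ^+ k) i j a)) (big_cat_nat (n := (mdegree M a).+1))//=.
rewrite -(big_mkord xpredT (fun k => (G ^+ k) i j a)) [in X in X - _]addrC addrK.
rewrite big_nat big1// => k /andP[ak _]; exact: linseries_pow_order.
Qed.

(** Modulo order [n] the series may be replaced by a partial sum [S], for which (I - G) S = I - G^n
    telescopes. *)
Lemma neumann_mul : (1%:M - G) *m neumann = 1%:M.
Proof.
apply/matrixP => i j; apply: (order_ge_eq (M := M)) => n.
pose S := \sum_(k < n) G ^+ k.
have SE : (1%:M - G) *m S = 1%:M - G ^+ n.
  by apply: oppr_inj; rewrite -mulNmx !opprB; exact/esym/subrX1.
have -> : ((1%:M - G) *m neumann) i j - (1%:M : 'M[fseries K]_N) i j =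
    - (((1%:M - G) *m (S - neumann)) i j + (G ^+ n) i j).
  by rewrite mulmxBr SE !mxE; ring.
apply/order_geN/order_geD; last exact: linseries_pow_order.
rewrite mxE; apply: order_ge_sum => l _; apply: order_geMl.
by have := @neumann_tail n l j; rewrite !mxE.
Qed.

End Neumann.

(** * Convergence of the Neumann series in the Kondratiev space *)

Section NeumannConvergence.
Variables (R : realType) (M N : nat) (A : 'I_M -> 'M[R[i]]_N).
Local Notation G := (linseries A).

(** One [r] serves all [n]: the remainder vanishes below degree [n] and has coefficients at most 2
    c^(|a|+1) elsewhere, so its squared norm decays like 2^(-n). *)
Lemma neumann_wick_geometric : wick_geometric G (neumann A).
Proof.
move=> i j; pose c := 1 + linnorm A; pose B := complex.Re c.
have c0 : 0 <= c by rewrite addr_ge0 ?linnorm_ge0.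
have c1 : 1 <= c by rewrite lerDl linnorm_ge0.
have Bc : real_complex R B = c by exact: toC_Re.
have B0 : 0 <= B by move: c0; rewrite lecE => /andP[].
have B1 : 1 <= B by rewrite -lecR Bc.
have [r Br] := exp2_ge (4 * B ^+ 2); exists r.
have partialM n : confined M ((\sum_(k < n) G ^+ k) i j) by exact: neumann_partial_confined.
have EM : confined M (neumann A i j) by exact: neumann_confined.
(* The coefficient at [a] comes from |a| + 1 powers of [G], whence the extra factor [B]. *)
have Ele a : `|neumann A i j a| <= real_complex R (B * B ^+ mdegree M a).
  by rewrite -exprS rmorphXn /= Bc mxE; exact: neumann_partial_bound.
split.
(* The constant B^n may depend on [n], as each norm only has to be finite. *)
- move=> n; apply: le_lt_trans (knorm2_le (exprn_ge0 n B0) B0 Br (partialM n) (order_ge0 _) _) _.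
    move=> a; rewrite rmorphM !rmorphXn /= Bc.
    apply: le_trans (neumann_partial_bound A n i j a) _.
    by rewrite ler_peMr ?exprn_ge0 ?exprn_ege1.
  by rewrite ltry.
- by apply: le_lt_trans (knorm2_le B0 B0 Br EM (order_ge0 _) Ele) _; rewrite ltry.
have B20 : 0 <= 2 * B by rewrite mulr_ge0.
have tail n : (knorm2 r ((\sum_(k < n) G ^+ k) i j - neumann A i j)%R <=
    ((2 * B) ^+ 2 * 2 ^+ M * 2^-1 ^+ n)%:E)%E.
  apply: (knorm2_le B20 B0 Br).
  - by move=> a k Mk ak; rewrite fseriesB (partialM n a k)// (EM a k)// subr0.
  - exact: neumann_tail.
  move=> a; have [an|na] := ltnP (mdegree M a) n.
    rewrite (@neumann_tail _ _ _ A n i j a an) normr0 -[0]/(real_complex R 0) lecR.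
    by rewrite mulr_ge0 ?exprn_ge0.
  rewrite fseriesB (le_trans (ler_normB _ _))// -mulrA mulr_natl mulr2n rmorphD lerD//.
  rewrite -exprS rmorphXn /= Bc (le_trans (neumann_partial_bound A n i j a))//.
  by rewrite ler_weXn2l// (leq_trans na).
apply: (@squeeze_cvge _ _ _ _ (fun=> 0%E) _ (fun n => ((2 * B) ^+ 2 * 2 ^+ M * 2^-1 ^+ n)%:E)).
- by apply: nearW => n; rewrite knorm2_ge0 tail.
- exact: cvg_cst.
- apply: cvg_EFin; first exact: nearW.
  by apply: cvg_geometric; rewrite ger0_norm ?invr_ge0// invf_lt1// (ltr_nat _ 1).
Qed.

End NeumannConvergence.

(** * Realizations through Cramer's rule *)

Section Realization.
Variables (K : numFieldType) (M N p q : nat).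
Variables (D : 'M[K]_(p, q)) (C : 'M[K]_(p, N)).
Variables (A : 'I_M -> 'M[K]_N) (B : 'I_M -> 'M[K]_(N, q)).

Definition realization_den : mpoly M K := \det (1%:M - linpoly A).

(** Cramer's rule cleared of denominators, so that it makes sense over polynomials. *)
Definition realization_num : 'M[mpoly M K]_(p, q) :=
  realization_den *: map_mx (@mpolyC M K) D +
  map_mx (@mpolyC M K) C *m \adj (1%:M - linpoly A) *m linpoly B.

(** Taking constant terms is a ring morphism that sends the matrix to the identity. *)
Lemma realization_den0 : mcoeff mnm0 realization_den = 1.
Proof.
rewrite /realization_den -det_map_mx map_mxB map_mx1.
rewrite (_ : map_mx _ (linpoly A) = 0) ?subr0 ?det1//.
apply/matrixP => i j; rewrite !mxE summxE raddf_sum big1// => k _ /=.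
by rewrite !mxE rmorphM /= mcoeffX mnm1_eq0 mul0r.
Qed.

Lemma tofrac_linpoly m n (L : 'I_M -> 'M[K]_(m, n)) :
  map_mx (@tofrac (mpoly M K)) (linpoly L) =
  \sum_(k < M) rvar K k *: map_mx (@rconst K M) (L k).
Proof.
apply/matrixP => i j; rewrite mxE !summxE raddf_sum; apply: eq_bigr => k _ /=.
by rewrite !mxE rmorphM.
Qed.

Lemma realization_fracE :
  map_mx (@rconst K M) D + map_mx (@rconst K M) C *m
    invmx (1%:M - \sum_(k < M) rvar K k *: map_mx (@rconst K M) (A k)) *m
    (\sum_(k < M) rvar K k *: map_mx (@rconst K M) (B k)) =
  (tofrac realization_den)^-1 *: map_mx (@tofrac (mpoly M K)) realization_num.
Proof.
rewrite -!tofrac_linpoly.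
have -> : 1%:M - map_mx (@tofrac (mpoly M K)) (linpoly A) =
    map_mx (@tofrac (mpoly M K)) (1%:M - linpoly A) by rewrite map_mxB map_mx1.
have d0 : tofrac realization_den != 0.
  rewrite tofrac_eq0; apply: contra_eq_neq realization_den0 => ->.
  by rewrite mcoeff0 eq_sym oner_eq0.
(* On a singular matrix [invmx] returns the matrix itself; invertibility makes it the adjugate over
   the determinant. *)
have Wu : map_mx (@tofrac (mpoly M K)) (1%:M - linpoly A) \in unitmx.
  by rewrite unitmxE det_map_mx unitfE.
have cC m n (L : 'M[K]_(m, n)) : map_mx (@rconst K M) L =
    map_mx (@tofrac (mpoly M K)) (map_mx (@mpolyC M K) L).
  by apply/matrixP => i j; rewrite !mxE.
rewrite /invmx Wu det_map_mx -/realization_den !cC /realization_num.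
rewrite -map_mx_adj [in RHS]map_mxD map_mxZ !map_mxM scalerDr scalerA mulVf// scale1r.
by rewrite -scalemxAr -scalemxAl.
Qed.

(** The equation d F = P has only one solution, because [d] is a unit of the Wick algebra. *)
Lemma realization_seriesE (F : 'M[fseries K]_(p, q)) :
  (forall i j, wickpoly realization_den * F i j = wickpoly (realization_num i j)) ->
  F = map_mx (@wconst K) D +
      map_mx (@wconst K) C *m neumann A *m linseries B.
Proof.
move=> HF; have GE := neumann_mul A.
have dE : wickpoly realization_den = \det (1%:M - linseries A).
  by rewrite /realization_den -det_map_mx map_mxB map_mx1 wickpoly_linpoly.
have dinv : wickpoly realization_den * \det (neumann A) = 1.
  by rewrite dE -det_mulmx GE det1.
have adjE : \adj (1%:M - linseries A) = wickpoly realization_den *: neumann A.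
  have := congr1 (mulmx (\adj (1%:M - linseries A))) GE.
  by rewrite mulmxA mul_adj_mx mul_scalar_mx mulmx1 dE.
have cC m n (L : 'M[K]_(m, n)) :
    map_mx (@wickpoly K M) (map_mx (@mpolyC M K) L) = map_mx (@wconst K) L.
  by apply/matrixP => i j; rewrite !mxE wickpolyC.
have dF : wickpoly realization_den *: F = map_mx (@wickpoly K M) realization_num.
  by apply/matrixP => i j; rewrite [LHS]mxE [RHS]mxE HF.
rewrite -[LHS]scale1r -dinv mulrC -scalerA dF /realization_num.
rewrite map_mxD map_mxZ !map_mxM /= map_mx_adj map_mxB map_mx1 !wickpoly_linpoly !cC.
by rewrite adjE -scalemxAr -scalemxAl -scalerDr scalerA mulrC dinv scale1r.
Qed.

End Realization.

(** * Passage from rational functions to their series *)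

Lemma ranalytic0_rtaylor0 (K : numFieldType) M (x : ratfun K M) :
  ranalytic0 x -> exists T, rtaylor0 x T.
Proof. by move=> [g xg /nbhs_singleton[T gT]]; exists T, g. Qed.

Lemma rtaylor0_kondratiev (R : realType) M (x : ratfun R[i] M) T :
  rtaylor0 x T -> kondratiev T.
Proof. by move=> [g _]; exact: taylor_kondratiev. Qed.

(** Holds for every fraction representing [x] whose denominator has nonzero constant term, reduced
    or not; Cramer's rule provides such a fraction. *)
Lemma rtaylor0_wickpoly (K : numFieldType) M (x : ratfun K M) (T : zseries K)
    (P d : mpoly M K) :
  rtaylor0 x T -> x = tofrac P / tofrac d -> mcoeff mnm0 d != 0 ->
  wickpoly d * T = wickpoly P.
Proof.
move=> [g xg gT] xE d0; apply: taylor_wickpoly_mul gT _.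
exact: rational_germ_near xg xE d0.
Qed.

Theorem theorem4p1 (R : realType) (M p q : nat)
    (f : 'M[ratfun R[i] M]_(p, q))
    (f_analytic : forall i j, ranalytic0 (f i j)) :
  exists F : 'M[fseries R[i]]_(p, q),
  [/\ forall i j, kondratiev (F i j),
      forall i j, rtaylor0 (f i j) (hermite (F i j)) &
      forall (N : nat) (D : 'M[R[i]]_(p, q)) (C : 'M[R[i]]_(p, N))
        (A : 'I_M -> 'M[R[i]]_N) (B : 'I_M -> 'M[R[i]]_(N, q)),
      f = map_mx (@rconst _ M) D +
          map_mx (@rconst _ M) C *m
          invmx (1%:M - \sum_(k < M) rvar _ k *: map_mx (@rconst _ M) (A k)) *m
          (\sum_(k < M) rvar _ k *: map_mx (@rconst _ M) (B k)) ->
      exists2 E : 'M[fseries R[i]]_N,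
        wick_geometric
          (\sum_(k < M) Hbasis R[i] [mset (k : nat)]%mset *:
             map_mx (@wconst R[i]) (A k)) E &
        F = map_mx (@wconst R[i]) D +
            map_mx (@wconst R[i]) C *m E *m
            (\sum_(k < M) Hbasis R[i] [mset (k : nat)]%mset *:
               map_mx (@wconst R[i]) (B k))].
Proof.
pose T i j := sval (cid (ranalytic0_rtaylor0 (f_analytic i j))).
have fT i j : rtaylor0 (f i j) (T i j) by exact: svalP.
exists (\matrix_(i, j) T i j); split => [i j|i j|N D C A B fE].
- by rewrite mxE; exact: rtaylor0_kondratiev (fT i j).
- by rewrite mxE.
(* [F] was fixed from [f] alone, so it serves every realization; only [E] depends on [A]. *)
exists (neumann A); first exact: neumann_wick_geometric.
apply: realization_seriesE => i j; rewrite mxE.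
apply: rtaylor0_wickpoly (fT i j) _ _; last by rewrite realization_den0 oner_neq0.
by rewrite fE realization_fracE !mxE mulrC.
Qed.
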